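(* For $n\ge 1$ let $\mathrm{Av}_n(213)$ denote the set of permutations $\pi=\pi_1\cdots\pi_n$ of $[n]=\{1,\dots,n\}$ avoiding the pattern $213$ (i.e. there are no indices $p<q<r$ with $\pi_q<\pi_p<\pi_r$). For a permutation $\pi$ of $[n]$ put $H(\pi)=\sum_{t=1}^{n-1}\min\{\pi_t,\pi_{t+1}\}$, and let $H_n=\sum_{\pi\in\mathrm{Av}_n(213)}H(\pi)$. Then for all $n\ge 1$, \[ H_n=\frac{n}{2}\binom{2n}{n}-4^{\,n-1}. \] Equivalently, the ordinary generating function $H(x)=\sum_{n\ge 1}H_nx^n$ equals $x(1-4x)^{-3/2}-x(1-4x)^{-1}$.
   Context: $H(\pi)$ is the number of horizontal edges of the grid graph of $\pi$: the graph with vertex set $\{(i,j):1\le i\le n,\ 1\le j\le \pi_i\}$, where $(i,j),(i',j')$ are adjacent iff either $i=i'$ and $|j-j'|=1$, or $|i-i'|=1$ and $j=j'$. *)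

(* Defs.v *)
From mathcomp Require Import all_boot all_order all_fingroup all_algebra.

Set Implicit Arguments.
Unset Strict Implicit.
Unset Printing Implicit Defensive.

Import GRing.Theory.

Local Open Scope ring_scope.

(* A permutation of {1, ..., n} is represented by [s : 'S_n], which acts on
   {0, ..., n - 1}; both positions and values are shifted by one. *)
Definition letter (n : nat) (s : 'S_n) (i : 'I_n) : nat := (s i).+1.

Definition avoids213 (n : nat) (s : 'S_n) : bool :=
  [forall p : 'I_n, forall q : 'I_n, forall r : 'I_n,
    (p < q)%N && (q < r)%N ==>
      ~~ ((letter s q < letter s p)%N && (letter s p < letter s r)%N)].

Definition Av213 (n : nat) : {set 'S_n} := [set s : 'S_n | avoids213 s].

(* The inner sum has one term [u = t + 1], and none when [t] is the last
   position. *)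
Definition Hperm (n : nat) (s : 'S_n) : nat :=
  (\sum_(t < n) \sum_(u < n | u == t.+1 :> nat)
     minn (letter s t) (letter s u))%N.

Definition Htotal (n : nat) : nat := (\sum_(s in Av213 n) Hperm s)%N.

(* The grid graph of a permutation. Columns and rows are both numbered from 0,
   and no column is higher than [n], so vertices live in ['I_n * 'I_n]. *)
Definition grid_vertices (n : nat) (s : 'S_n) : {set 'I_n * 'I_n} :=
  [set v : 'I_n * 'I_n | (v.2 < letter s v.1)%N].

Definition grid_adj (n : nat) (u v : 'I_n * 'I_n) : bool :=
  (u.1 == v.1) && (`|u.2 - v.2|%N == 1%N)
  || (`|u.1 - v.1|%N == 1%N) && (u.2 == v.2).

Definition horizontal_edges (n : nat) (s : 'S_n) : {set {set 'I_n * 'I_n}} :=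
  [set [set u; v] | u in grid_vertices s, v in grid_vertices s
                  & grid_adj u v && (u.2 == v.2)].

Lemma distn1 (a b : nat) :
  (`|a - b|%N == 1%N) = (b == a.+1) || (a == b.+1).
Proof.
case: (leqP a b) => [ab | /ltnW ba].
  rewrite distnEr // -(eqn_add2r a) subnK // add1n.
  by case: eqP => //= _; apply/esym/negP => /eqP e; rewrite e ltnn in ab.
rewrite distnEl // -(eqn_add2r b) subnK // add1n orbC.
by case: eqP => //= _; apply/esym/negP => /eqP e; rewrite e ltnn in ba.
Qed.

Lemma card_horizontal_edges (n : nat) (s : 'S_n) :
  #|horizontal_edges s| = Hperm s.
Proof.
pose D := [set x : 'I_n * 'I_n * 'I_n |
  (x.1.2 == x.1.1.+1 :> nat) && (x.2 < minn (letter s x.1.1) (letter s x.1.2))%N].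
pose e (x : 'I_n * 'I_n * 'I_n) := [set (x.1.1, x.2); (x.1.2, x.2)].
have -> : horizontal_edges s = e @: D.
  apply/setP=> E; apply/imset2P/imsetP.
    case=> -[a b] [c d]; rewrite !inE /= => ab /and3P[cd adj /eqP bd] ->{E}.
    subst d; move: adj; rewrite /grid_adj /= distnn andbF eqxx andbT orFb distn1.
    case/orP => /eqP h.
      by exists (a, c, b) => //; rewrite inE /= h eqxx leq_min ab cd.
    exists (c, a, b); first by rewrite inE /= h eqxx leq_min ab cd.
    by rewrite /e /= setUC.
  case=> -[[a c] b]; rewrite inE /= leq_min => /and3P[/eqP h ab cb] ->.
  exists (a, b) (c, b); rewrite ?inE //= cb /grid_adj /= eqxx !andbT (distn1 a c) h.
  by rewrite eqxx orbT.
rewrite card_in_imset; last first.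
  move=> [[a c] b] [[a' c'] b']; rewrite !inE /= => /andP[/eqP h _].
  case/andP=> /eqP h' _ /setP E.
  have := E (a, b); have := E (c, b).
  rewrite !inE !xpair_eqE !eqxx /= orbT.
  case/esym/orP=> /andP[/eqP cc /eqP bb]; case/esym/orP=> /andP[/eqP aa _].
  - by move: h; rewrite aa cc => /eqP; rewrite -[X in X == _]addn0 -addn1
      eqn_add2l.
  - by exfalso; move: h; rewrite aa cc h' => /eqP;
      rewrite -addn2 -[X in X == _]addn0 eqn_add2l.
  - by rewrite aa bb cc.
  - by move: h; rewrite aa cc => /eqP; rewrite -[X in X == _]addn0 -addn1
      eqn_add2l.
rewrite /Hperm pair_big_dep /= -sum1_card.
rewrite (partition_big (fun x : 'I_n * 'I_n * 'I_n => x.1)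
  (fun p : 'I_n * 'I_n => p.2 == p.1.+1 :> nat)) /=; last first.
  by move=> x; rewrite inE => /andP[].
apply: eq_bigr => -[t u] /= htu.
set m := minn _ _.
have mn : (m <= n)%N by rewrite geq_min ltn_ord.
rewrite (reindex_onto (fun b : 'I_n => ((t, u), b)) (fun x => x.2)) /=; last first.
  by move=> [x b] /andP[_ /eqP /= <-].
rewrite (eq_bigl (fun b : 'I_n => b < m)%N); last first.
  by move=> b; rewrite inE /= htu !eqxx !andbT.
by rewrite -(big_ord_widen n (fun _ => 1%N) mn) sum1_card card_ord.
Qed.

(* Formal power series over the rationals are coefficient sequences
   [nat -> rat], with pointwise subtraction [f \- g]. *)
Definition fps_X : nat -> rat := fun k => (k == 1%N)%:R.

Definition fps_mul (f g : nat -> rat) : nat -> rat :=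
  fun k => \sum_(i < k.+1) f i * g (k - i)%N.

(* The binomial series (1 + c x)^a, whose k-th coefficient is
   a (a - 1) ... (a - k + 1) / k! * c^k. *)
Definition fps_binomial (c a : rat) : nat -> rat :=
  fun k => (\prod_(i < k) (a - i%:R)) / (k`!)%:R * c ^+ k.

Definition Hogf : nat -> rat :=
  fun k => if (0 < k)%N then (Htotal k)%:R else 0.

(* Main.v *)
Require Import Defs.
From mathcomp Require Import all_boot all_order all_fingroup all_algebra.
From mathcomp Require Import zify ring.

(* A 213-avoiding word with distinct letters and minimum m splits as L m R,
   where L and R avoid 213 and every letter of L exceeds every letter of R.
   Raising all letters of a word of length a > 0 by k adds k (a - 1) to H, so
   the totals over words on m, ..., m + n - 1 satisfy a Catalan-type
   recursion in n. With C(x), B(x) = (1 - 4x)^(-1/2) the generating functions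
   of the Catalan numbers and central binomial coefficients, the closed form
   satisfies it because of the convolutions C^2, B C, B^2, (x B') C and (1 -
   4x)^(-1) C. Each of these follows by induction from the first-order
   recurrences of the coefficients; for squares f^2 one combines them with 2
   (x f') f = x (f^2)'. *)

Import GRing.Theory Num.Theory.

Local Open Scope nat_scope.

(** * Words avoiding 213 *)

Fixpoint word_av213 (w : seq nat) : bool :=
  if w is x :: v then
    pairwise (fun y z => ~~ ((y < x) && (x < z))) v && word_av213 v
  else true.

(* The last letter contributes [minn x 0 = 0]. *)
Fixpoint word_H (w : seq nat) : nat :=
  if w is x :: v then minn x (head 0 v) + word_H v else 0.

Lemma word_av213P (w : seq nat) :
  reflect (forall p q r, p < q -> q < r -> r < size w ->
             ~~ ((nth 0 w q < nth 0 w p) && (nth 0 w p < nth 0 w r)))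
          (word_av213 w).
Proof.
elim: w => [|x v IH] /=; first by apply: ReflectT.
apply: (iffP andP) => [[/(pairwiseP 0) hx /IH hv] | h].
  case=> [|p] [|q] [|r] //; rewrite !ltnS => pq qr rv /=.
    by apply: hx => //; rewrite inE //; apply: ltn_trans rv.
  exact: hv.
split; first by apply/(pairwiseP 0) => q r _ rv qr; apply: (h 0 q.+1 r.+1).
by apply/IH => p q r; apply: (h p.+1 q.+1 r.+1).
Qed.

(** At the last position [nth] reads its default 0 past the end, matching the zero last term of
    [word_H]. *)
Lemma word_HE (w : seq nat) :
  word_H w = \sum_(t < size w) minn (nth 0 w t) (nth 0 w t.+1).
Proof.
elim: w => [|x v IH] /=; first by rewrite big_ord0.
by rewrite big_ord_recl IH nth0.
Qed.

(** For a letter x of L, m can serve as the 1, so no letter of R may exceed x. Once this holds,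
    nothing in [m :: R] can be the 3 above x, and only patterns inside L or inside R remain. *)
Lemma word_av213_cat_min (m : nat) (L R : seq nat) :
  all (ltn m) L -> all (ltn m) R ->
  word_av213 (L ++ m :: R) =
  [&& word_av213 L, word_av213 R & allrel geq L R].
Proof.
move=> mL mR; elim: L mL => [_|x L IH /andP[/= mx /IH IHL]] /=.
  rewrite andbT; case: (word_av213 R); rewrite ?andbF ?andbT //.
  apply/(pairwiseP 0) => q r qR _ _; apply/nandP; left.
  by rewrite -leqNgt ltnW //; apply: (all_nthP 0 mR).
rewrite IHL pairwise_cat /= mx /= allrel_consl.
have -> : all (fun z => ~~ (x < z)) R = all (geq x) R.
  by apply: eq_all => z; rewrite -leqNgt.
case xR: (all (geq x) R); rewrite /= ?andbF //.
have notgt z : z \in m :: R -> ~~ (x < z).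
  by rewrite inE -leqNgt => /predU1P[->|/(allP xR)//]; apply: ltnW.
have -> : pairwise (fun y z => ~~ ((y < x) && (x < z))) R.
  apply/(pairwiseP 0) => q r _ rR _; apply/nandP; right; apply: notgt.
  by rewrite inE mem_nth ?orbT.
have -> : allrel (fun y z => ~~ ((y < x) && (x < z))) L (m :: R).
  by apply/allrelP => y z _ zR; apply/nandP; right; apply: notgt.
by rewrite andbT andbA.
Qed.

(** Each neighbour of the minimum contributes exactly m; an empty side has no neighbour to
    contribute. *)
Lemma word_H_cat_min (m : nat) (L R : seq nat) :
  all (leq m) L -> all (leq m) R ->
  word_H (L ++ m :: R) =
  word_H L + word_H R + (L != [::]) * m + (R != [::]) * m.
Proof.
move=> mL mR; elim: L mL => [_|x L IH /andP[mx mL]] /=.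
  by case: R mR => [|y R] //= /andP[my _]; lia.
by case: L IH mL => [|y L] IH mL; rewrite /= in IH mL *; have := IH mL; lia.
Qed.

(** * Decomposition of words on an interval at their minimum *)

Definition words213 (m n : nat) : seq (seq nat) :=
  [seq w <- permutations (iota m n) | word_av213 w].

Lemma mem_words213 (m n : nat) (w : seq nat) :
  (w \in words213 m n) = word_av213 w && perm_eq w (iota m n).
Proof. by rewrite mem_filter mem_permutations. Qed.

Lemma words213_uniq (m n : nat) : uniq (words213 m n).
Proof. by rewrite filter_uniq ?permutations_uniq. Qed.

Lemma size_words213 (m n : nat) (w : seq nat) :
  w \in words213 m n -> size w = n.
Proof. by rewrite mem_words213 => /andP[_ /perm_size]; rewrite size_iota. Qed.

Lemma words213_ge (m n : nat) (w : seq nat) :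
  w \in words213 m n -> all (leq m) w.
Proof.
rewrite mem_words213 => /andP[_ /perm_mem h]; apply/allP => x.
by rewrite h mem_iota => /andP[].
Qed.

(** Sorting R and L separately and putting R first gives a sorted list, which by uniqueness of
    sorting is the interval itself; cut it at [size R]. *)
Lemma perm_cat_iota (m n : nat) (L R : seq nat) :
  allrel geq L R -> perm_eq (L ++ R) (iota m n) ->
  perm_eq L (iota (m + size R) (n - size R)) /\ perm_eq R (iota m (size R)).
Proof.
move=> LR p; have sz : size L + size R = n.
  by rewrite -size_cat (perm_size p) size_iota.
have e : sort leq R ++ sort leq L = iota m (size R + (n - size R)).
  apply: (sorted_eq leq_trans anti_leq); last 1 first.
  - rewrite subnKC -?sz ?leq_addl // sz; apply: perm_trans p.
    by rewrite perm_catC perm_cat // perm_sort.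
  - rewrite sorted_pairwise ?pairwise_cat -?sorted_pairwise;
      try exact: leq_trans.
    rewrite !sort_sorted; try exact: leq_total.
    rewrite !andbT; apply/allrelP => x y; rewrite !mem_sort => xR yL.
    exact: (allrelP LR).
  by apply: sub_sorted (iota_ltn_sorted _ _) => x y /ltnW.
move: e; rewrite iotaD => /eqP; rewrite eqseq_cat; last first.
  by rewrite size_sort size_iota.
by case/andP=> /eqP <- /eqP <-; rewrite !(perm_sym _ (sort _ _)) !perm_sort.
Qed.

(* The letters before the minimum exceed those after it, since otherwise the
   minimum would play the role of the 1 in a pattern 213. *)
Lemma words213S (m n : nat) :
  perm_eq (words213 m n.+1)
    [seq w | b <- iota 0 n.+1,
       w <- [seq L ++ m :: R | L <- words213 (m + b.+1) (n - b),
                               R <- words213 m.+1 b]].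
Proof.
apply: uniq_perm; first exact: words213_uniq.
  (* The position n - b of the minimum recovers b, so different b give disjoint families. *)
  have index_min b w :
      w \in [seq L ++ m :: R | L <- words213 (m + b.+1) (n - b),
                               R <- words213 m.+1 b] ->
      index m w = n - b.
    case/allpairsP=> -[L R] /= [Lw _ ->]; rewrite index_cat /= eqxx addn0.
    rewrite (size_words213 _ _ _ Lw) ifN //.
    apply/negP => /(allP (words213_ge _ _ _ Lw)).
    by rewrite addnS ltnNge leq_addr.
  apply: allpairs_uniq_dep; first exact: iota_uniq.
    move=> b _; apply: allpairs_uniq; try exact: words213_uniq.
    move=> [L R] [L' R'] /allpairsP[[L1 R1] /= [Lw _ [-> _]]].
    case/allpairsP=> -[L2 R2] /= [Lw' _ [-> _]] /eqP.
    rewrite eqseq_cat ?(size_words213 _ _ _ Lw) ?(size_words213 _ _ _ Lw') //.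
    by case/andP=> /eqP -> /eqP[->].
  move=> u v /allpairsPdep[b [w [bn bw ->]]].
  case/allpairsPdep=> b' [w' [bn' bw' ->]] /= e.
  rewrite -{}e in bw' *; move: bn bn'; rewrite !mem_iota => bn bn'.
  have := index_min b w bw; rewrite (index_min b' w bw') => bb'.
  by have -> : b = b' by lia.
move=> w; apply/idP/allpairsPdep => [| [b [v [bn wv ->]]]]; last first.
  case/allpairsP: wv=> -[L R] /= [Lw Rw ->].
  have mL : all (ltn m) L.
    by apply: sub_all (words213_ge _ _ _ Lw) => x /=; lia.
  have mR := words213_ge _ _ _ Rw.
  move: (Lw) (Rw); rewrite !mem_words213 => /andP[aL pL] /andP[aR pR].
  rewrite word_av213_cat_min // aL aR /=; apply/andP; split.
    apply/allrelP => x y; rewrite (perm_mem pL) (perm_mem pR) !mem_iota /=; lia.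
  rewrite -cat1s perm_catCA cat1s perm_cons perm_catC.
  have -> : iota m.+1 n = iota m.+1 b ++ iota (m + b.+1) (n - b).
    rewrite addnS -addSn -iotaD subnKC //.
    by move: bn; rewrite mem_iota ltnS.
  exact: perm_cat.
rewrite mem_words213 => /andP[aw pw].
have mw : m \in w by rewrite (perm_mem pw) inE eqxx.
case/splitPr: mw aw pw => L R aw pw.
have {}pw : perm_eq (L ++ R) (iota m.+1 n).
  by rewrite -(perm_cons m); apply: perm_trans pw; rewrite -cat1s perm_catCA.
have : all (ltn m) (L ++ R).
  by apply/allP => x; rewrite (perm_mem pw) mem_iota => /andP[].
rewrite all_cat => /andP[mL mR].
move: aw; rewrite word_av213_cat_min // => /and3P[aL aR LR].
have [pL pR] := perm_cat_iota _ _ _ _ LR pw.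
have szR : size R <= n.
  by rewrite -(size_iota m.+1 n) -(perm_size pw) size_cat leq_addl.
exists (size R), (L ++ m :: R); split=> //; first by rewrite mem_iota.
apply/allpairsP; exists (L, R); split=> //=; rewrite mem_words213 ?aL ?aR //.
by rewrite addnS -addSn.
Qed.

Local Open Scope ring_scope.

(** * Catalan convolutions *)

Lemma fps_mulC (f g : nat -> rat) (n : nat) : fps_mul f g n = fps_mul g f n.
Proof.
rewrite /fps_mul (reindex_inj rev_ord_inj) /=; apply: eq_bigr => i _.
by rewrite subSS subKn 1?mulrC // -ltnS.
Qed.

Lemma fps_mulSl (f g : nat -> rat) (n : nat) :
  fps_mul f g n.+1 = f 0%N * g n.+1 + fps_mul (fun k => f k.+1) g n.
Proof. by rewrite /fps_mul big_ord_recl subn0. Qed.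

Lemma eq_fps_mull (f f' g : nat -> rat) (n : nat) :
  f =1 f' -> fps_mul f g n = fps_mul f' g n.
Proof. by move=> ff'; apply: eq_bigr => i _; rewrite ff'. Qed.

Lemma fps_mul_lincomb (a b : rat) (f f' g : nat -> rat) (n : nat) :
  fps_mul (fun k => a * f k + b * f' k) g n =
  a * fps_mul f g n + b * fps_mul f' g n.
Proof.
rewrite /fps_mul !mulr_sumr -big_split; apply: eq_bigr => i _ /=; ring.
Qed.

(* [2 (x f') f = x (f ^ 2)']. *)
Lemma fps_mul_deriv_self (f : nat -> rat) (n : nat) :
  2%:R * fps_mul (fun k => k%:R * f k) f n = n%:R * fps_mul f f n.
Proof.
rewrite mulr_natl mulr2n {2}fps_mulC /fps_mul -big_split mulr_sumr.
apply: eq_bigr => i _ /=; rewrite natrB -1?ltnS //; ring.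
Qed.

Definition central_binomial (n : nat) : rat := 'C(2 * n, n)%:R.

Definition catalan (n : nat) : rat := central_binomial n / n.+1%:R.

Local Notation B := central_binomial.
Local Notation C := catalan.

Lemma central_binomial0 : B 0 = 1.
Proof. by rewrite /B. Qed.

Lemma central_binomialS (n : nat) :
  n.+1%:R * B n.+1 = (4%:R * n%:R + 2%:R) * B n.
Proof.
rewrite /central_binomial -!natrM -natrD -natrM; congr _%:R.
have -> : (2 * n.+1 = (2 * n).+2)%N by lia.
rewrite -mul_bin_diag /=; have := mul_bin_down (2 * n).+1 n.
have -> : ((2 * n).+1 - n = n.+1)%N by lia.
rewrite /=; lia.
Qed.

Lemma catalan0 : C 0 = 1.
Proof. by rewrite /C central_binomial0 divr1. Qed.

Lemma central_binomial_catalan (n : nat) : B n = n%:R * C n + C n.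
Proof.
have := pnatr_eq0 rat n.+1; rewrite /= /C -natr1 => /negbT n0; by field.
Qed.

Lemma catalanS (n : nat) :
  (n%:R + 2%:R) * C n.+1 = (4%:R * n%:R + 2%:R) * C n.
Proof.
have n0 : (n%:R + 1 : rat) != 0 by rewrite natr1 pnatr_eq0.
apply: (mulfI n0); have := central_binomialS n.
rewrite !central_binomial_catalan -natr1 => e.
transitivity ((n%:R + 1) * ((n%:R + 1) * C n.+1 + C n.+1)); first by ring.
by rewrite e; ring.
Qed.

(** Coefficient form of (1 - 4x) B = 1 - 2x C. *)
Lemma central_binomial_succ (n : nat) : B n.+1 = 4%:R * B n - 2%:R * C n.
Proof.
rewrite !central_binomial_catalan -natr1.
transitivity ((n%:R + 2%:R) * C n.+1); first by ring.
by rewrite catalanS; ring.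
Qed.

Lemma fps_mul_central_binomial_sqr (n : nat) : fps_mul B B n = 4%:R ^+ n.
Proof.
elim: n => [|n IH]; first by rewrite /fps_mul big_ord1.
have n0 : (n.+1%:R : rat) != 0 by rewrite pnatr_eq0.
apply: (mulfI n0); rewrite -fps_mul_deriv_self fps_mulSl /= !mul0r add0r.
rewrite (eq_fps_mull _ (fun k => 4%:R * (k%:R * B k) + 2%:R * B k)); last first.
  by move=> k; rewrite central_binomialS; ring.
rewrite fps_mul_lincomb mulrDr mulrCA fps_mul_deriv_self IH exprS -natr1; ring.
Qed.

Lemma fps_mul_catalan_sqr (n : nat) : fps_mul C C n = C n.+1.
Proof.
have n2 k : (k%:R + 2%:R : rat) != 0 by rewrite -natrD pnatr_eq0 addn2.
elim: n => [|n IH].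
  rewrite /fps_mul big_ord1 catalan0; apply: (mulfI (n2 0%N)).
  by rewrite catalanS catalan0.
apply: (mulfI (n2 n.+1)); rewrite catalanS.
(* The left factor is B = (x C)', expanded by B = 1 + x (4B - 2C) with 4B - 2C = 4x C' + 2C. *)
have e : fps_mul (fun k => 1 * (k%:R * C k) + 1 * C k) C n.+1 =
         C n.+1 + 4%:R * fps_mul (fun k => k%:R * C k) C n
                + 2%:R * fps_mul C C n.
  rewrite fps_mulSl catalan0 mulr0 add0r !mul1r -addrA; congr (_ + _).
  rewrite -fps_mul_lincomb; apply: eq_fps_mull => k.
  rewrite !mul1r -central_binomial_catalan central_binomial_succ.
  by rewrite central_binomial_catalan; ring.
have := fps_mul_deriv_self C n.+1; have := fps_mul_deriv_self C n.
rewrite IH; move: e; rewrite fps_mul_lincomb !mul1r => e en en1.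
(* Since 2 (x C') C = x (C^2)', the factor n + 3 turns into twice the left side of [e]. *)
transitivity (2%:R * (fps_mul (fun k => k%:R * C k) C n.+1 + fps_mul C C n.+1)).
  by rewrite mulrDr en1; ring.
rewrite e IH.
transitivity (2%:R * C n.+1 + 4%:R * (2%:R * fps_mul (fun k => k%:R * C k) C n)
              + 4%:R * C n.+1); first by ring.
rewrite en -natr1; ring.
Qed.

(** From B = x C' + C one gets 2 B C = x (C^2)' + 2 C^2, and C^2 is known. *)
Lemma fps_mul_central_binomial_catalan (n : nat) :
  2%:R * fps_mul B C n = B n.+1.
Proof.
rewrite (eq_fps_mull _ (fun k => 1 * (k%:R * C k) + 1 * C k)); last first.
  by move=> k; rewrite central_binomial_catalan !mul1r.
rewrite fps_mul_lincomb !mul1r mulrDr fps_mul_deriv_self fps_mul_catalan_sqr.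
by rewrite central_binomial_catalan -natr1; ring.
Qed.

(** Both sides satisfy u(n+1) = 4 u(n) + 2 C(n+1). *)
Lemma fps_mul_pow4_catalan (n : nat) :
  2%:R * fps_mul (fun k => 4%:R ^+ k) C n = 4%:R ^+ n.+1 - B n.+1.
Proof.
elim: n => [|n IH]; first by rewrite /fps_mul big_ord1 catalan0.
rewrite fps_mulSl (eq_fps_mull _ (fun k => 4%:R * 4%:R ^+ k + 0 * 0)).
  rewrite (fps_mul_lincomb _ _ _ (fun=> 0)) mul0r addr0 mulrDr.
  rewrite [2%:R * (4%:R * _)]mulrCA IH.
  by rewrite (central_binomial_succ n.+1) [4%:R ^+ n.+2]exprS; ring.
by move=> k; rewrite exprS mul0r addr0.
Qed.

(** Convolving the recurrence of B with C gives u(n+1) = 4 u(n) + B(n+1), by the value of 2 B C. *)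
Lemma fps_mul_deriv_central_binomial_catalan (n : nat) :
  fps_mul (fun k => k%:R * B k) C n
  = n.+1%:R / 2%:R * B n.+1 - 4%:R ^+ n.
Proof.
elim: n => [|n IH].
  by rewrite /fps_mul big_ord1 /= !mul0r.
rewrite fps_mulSl /= !mul0r add0r.
rewrite (eq_fps_mull _ (fun k => 4%:R * (k%:R * B k) + 2%:R * B k)); last first.
  by move=> k; rewrite central_binomialS; ring.
rewrite fps_mul_lincomb IH fps_mul_central_binomial_catalan.
rewrite [n.+2%:R / _ * _]mulrAC central_binomialS exprS -natr1; by field.
Qed.

(** * The two binomial series of the generating function *)

Lemma fps_binomial_pow4 (k : nat) : fps_binomial (- 4%:R) (- 1) k = 4%:R ^+ k.
Proof.
rewrite /fps_binomial; elim: k => [|k IH]; first by rewrite big_ord0.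
have k0 : (k.+1%:R : rat) != 0 by rewrite pnatr_eq0.
have f0 : (k`!%:R : rat) != 0 by rewrite pnatr_eq0 -lt0n fact_gt0.
rewrite [4%:R ^+ _]exprS -IH big_ord_recr /= factS natrM exprS.
rewrite -natr1 in k0 *.
by field; rewrite f0.
Qed.

(** Differentiating B = (1 - 4x)^(-1/2) gives B' = 2 (1 - 4x)^(-3/2), hence half the coefficients of
    B'. *)
Lemma fps_binomial_central_binomial (k : nat) :
  fps_binomial (- 4%:R) (- (3%:R / 2%:R)) k = k.+1%:R / 2%:R * B k.+1.
Proof.
rewrite [RHS]mulrAC central_binomialS.
rewrite /fps_binomial; elim: k => [|k IH]; first by rewrite big_ord0.
have k0 : (k.+1%:R : rat) != 0 by rewrite pnatr_eq0.
have f0 : (k`!%:R : rat) != 0 by rewrite pnatr_eq0 -lt0n fact_gt0.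
apply: (mulfI k0).
transitivity ((4%:R * k.+1%:R + 2%:R) / 2%:R * (k.+1%:R * B k.+1));
  last by ring.
rewrite central_binomialS.
transitivity ((4%:R * k%:R + 6%:R) *
  ((4%:R * k%:R + 2%:R) * B k / 2%:R)); last by rewrite -natr1; field.
rewrite -IH big_ord_recr /= factS natrM exprS.
rewrite -natr1 in k0 *.
by field; rewrite f0.
Qed.

Lemma fps_mulX (f : nat -> rat) (n : nat) :
  fps_mul fps_X f n = if n is k.+1 then f k else 0.
Proof.
case: n => [|k]; first by rewrite /fps_mul big_ord1 mul0r.
rewrite fps_mulSl mul0r add0r /fps_mul big_ord_recl subn0 mul1r.
by rewrite big1 ?addr0 // => i _; rewrite mul0r.
Qed.

(** * The total over 213-avoiding words *)

Lemma sum_words213S (V : nmodType) (F : seq nat -> V) (m n : nat) :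
  \sum_(w <- words213 m n.+1) F w =
  \sum_(b < n.+1) \sum_(L <- words213 (m + b.+1) (n - b))
    \sum_(R <- words213 m.+1 b) F (L ++ m :: R).
Proof.
rewrite (perm_big _ (words213S m n)) big_allpairs_dep.
have -> : iota 0 n.+1 = index_iota 0 n.+1 by rewrite /index_iota subn0.
rewrite big_mkord.
by apply: eq_bigr => b _; rewrite big_allpairs_dep.
Qed.

(** Splitting at the minimum gives the recursion C(n+1) = (C^2)(n), whatever m is. *)
Lemma card_words213 (m n : nat) : (size (words213 m n))%:R = C n.
Proof.
elim/ltn_ind: n m => -[|n] IH m; first by rewrite catalan0.
rewrite -sum1_size natr_sum sum_words213S -fps_mul_catalan_sqr.
apply: eq_bigr => b _.
under eq_bigr do rewrite -natr_sum sum1_size IH 1?ltn_ord //.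
rewrite big_const_seq count_predT iter_addr addr0 -mulr_natr IH //.
by rewrite ltnS leq_subr.
Qed.

Lemma sum_pairs_add (I J : Type) (s : seq I) (t : seq J)
    (f : I -> rat) (g : J -> rat) (c : rat) :
  \sum_(x <- s) \sum_(y <- t) (f x + g y + c) =
  (size t)%:R * \sum_(x <- s) f x + (size s)%:R * \sum_(y <- t) g y
  + (size s)%:R * (size t)%:R * c.
Proof.
have const K (u : seq K) a : \sum_(z <- u) a = (size u)%:R * a :> rat.
  by rewrite big_const_seq count_predT iter_addr addr0 mulr_natl.
under eq_bigr do rewrite 2!big_split /= !const.
by rewrite !big_split /= !const -mulr_sumr; ring.
Qed.

(* The last summand corrects the junk value at [n = 0]. *)
Lemma sum_word_H_words213 (m n : nat) :
  \sum_(w <- words213 m n) (word_H w)%:R =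
  n%:R / 2%:R * B n - 4%:R ^+ n / 4%:R + (m%:R - 1) * (n%:R - 1) * C n
  + (n == 0%N)%:R * (m%:R - 3%:R / 4%:R).
Proof.
elim/ltn_ind: n m => -[|n] IH m.
  by rewrite big_seq1 /= catalan0 mul1r; field.
pose h k := k%:R * B k; pose pow4 k := 4%:R ^+ k : rat.
(* Put a = n - b. The m-terms of L, of R and of the two edges at the minimum add up to m (a + b) = m
   n. The bracket is the sum of b (a - 1) C(a) C(b), from raising L by b, as b C(b) = B(b) - C(b)
   and (a - 1) C(a) = B(a) - 2 C(a). The last two sums correct the cases where L or R is empty. *)
transitivity (1 / 2%:R * fps_mul h C n + 1 / 2%:R * fps_mul C h n
  - 1 / 4%:R * fps_mul pow4 C n - 1 / 4%:R * fps_mul C pow4 n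
  + m%:R * n%:R * fps_mul C C n
  + (fps_mul B B n - 2%:R * fps_mul B C n - fps_mul C B n
     + 2%:R * fps_mul C C n)
  + \sum_(b < n.+1) (b == n :> nat)%:R * ((n%:R + 1 / 4%:R) * C n)
  + \sum_(b < n.+1) (b == 0 :> nat)%:R * (C n / 4%:R)).
  rewrite /fps_mul !mulr_sumr -!sumrN -!big_split sum_words213S /=.
  apply: eq_bigr => b _.
  have bn : (b <= n)%N by rewrite -ltnS.
  transitivity (\sum_(L <- words213 (m + b.+1) (n - b))
    \sum_(R <- words213 m.+1 b)
    ((word_H L)%:R + (word_H R)%:R +
     (((n - b != 0)%N)%:R * m%:R + (b != 0 :> nat)%:R * m%:R) : rat)).
    rewrite big_seq [RHS]big_seq; apply: eq_bigr => L Lw.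
    rewrite big_seq [RHS]big_seq; apply: eq_bigr => R Rw.
    rewrite word_H_cat_min.
    - by rewrite -!size_eq0 (size_words213 _ _ _ Lw) (size_words213 _ _ _ Rw)
        !natrD !natrM addrA.
    - by apply: sub_all (words213_ge _ _ _ Lw) => x /=; lia.
    - by apply: sub_all (words213_ge _ _ _ Rw) => x /=; lia.
  rewrite sum_pairs_add !IH ?ltnS ?leq_subr // !card_words213 {IH}.
  rewrite /h /pow4 !central_binomial_catalan.
  move: (nat_of_ord b) bn => {b} b /subnKC; move: (n - b)%N => a <-.
  have -> : (b == b + a)%N = (a == 0)%N by lia.
  case: a => [|a]; case: b => [|b]; rewrite ?addn0 ?add0n ?catalan0 /= ?eqxx;
    by field.
rewrite (fps_mulC C h) (fps_mulC C pow4) (fps_mulC C B).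
rewrite fps_mul_deriv_central_binomial_catalan fps_mul_catalan_sqr.
rewrite fps_mul_central_binomial_sqr.
have -> : fps_mul pow4 C n = (4%:R ^+ n.+1 - B n.+1) / 2%:R.
  by rewrite -fps_mul_pow4_catalan; field.
have -> : fps_mul B C n = B n.+1 / 2%:R.
  by rewrite -fps_mul_central_binomial_catalan; field.
rewrite big_ord_recr big_ord_recl /= !eqxx /= !big1 => [||b _]; last 2 first.
- by move=> b _; rewrite mul0r.
- by rewrite ltn_eqF ?ltn_ord // mul0r.
apply/eqP; rewrite -subr_eq0; apply/eqP.
(* The two sides differ by -1/4 times the first-order Catalan recurrence. *)
transitivity (- (1 / 4%:R) *
  ((n%:R + 2%:R) * C n.+1 - (4%:R * n%:R + 2%:R) * C n)); last first.
  by rewrite catalanS subrr mulr0.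
rewrite central_binomial_catalan exprS; by field.
Qed.

(** * From permutations to words *)

Lemma Htotal_words213 (n : nat) :
  Htotal n = (\sum_(w <- words213 1 n) word_H w)%N.
Proof.
(* One-line notation, shown below to map [Av213 n] bijectively onto [words213 1 n] and to carry
   [Hperm] to [word_H]. *)
pose word (s : 'S_n) := [seq letter s i | i <- enum 'I_n].
have nth_word s (i : 'I_n) : nth 0%N (word s) i = letter s i.
  by rewrite (nth_map i) ?size_enum_ord // nth_ord_enum.
have size_word s : size (word s) = n by rewrite size_map size_enum_ord.
have word_inj : injective word.
  move=> s t st; apply/permP => i; apply/val_inj/eqP.
  by rewrite -eqSS -!/(letter _ i) -!nth_word st.
have H_word s : word_H (word s) = Hperm s.
  rewrite word_HE size_word; apply: eq_bigr => t _; rewrite nth_word.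
  case: (ltnP t.+1 n) => tn.
    by rewrite (big_pred1 (Ordinal tn)) // -(nth_word s (Ordinal tn)).
  (* At the last position the default letter is 0 and the inner sum of [Hperm] is empty. *)
  rewrite nth_default ?size_word // minn0 big_pred0 // => u.
  by apply/negP => /eqP ut; rewrite -ut leqNgt ltn_ord in tn.
have av_word s : word_av213 (word s) = avoids213 s.
  apply/word_av213P/forallP => [h p | h p q r pq qr].
    apply/forallP => q; apply/forallP => r; apply/implyP => /andP[pq qr].
    by rewrite -!nth_word; apply: h; rewrite ?size_word.
  rewrite size_word => rn.
  have qn := ltn_trans qr rn; have pn := ltn_trans pq qn.
  have := h (Ordinal pn).
  move=> /forallP/(_ (Ordinal qn))/forallP/(_ (Ordinal rn))/implyP.
  by rewrite -!nth_word; apply; apply/andP.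
have perm_word s : perm_eq (word s) (iota 1 n).
  apply: uniq_perm (iota_uniq _ _) _.
    rewrite map_inj_uniq; first exact: enum_uniq.
    by move=> i j /= /succn_inj /val_inj /perm_inj.
  move=> x; rewrite mem_iota add1n ltnS; apply/mapP/andP => [[i _ ->]|].
    by rewrite /letter ltn_ord.
  case: x => [[] //|x [_ xn]]; exists (s^-1%g (Ordinal xn)).
    by rewrite mem_enum.
  by rewrite /letter permKV.
have words_E : perm_eq (words213 1 n) [seq word s | s <- enum (Av213 n)].
  apply: uniq_perm; rewrite ?words213_uniq ?map_inj_uniq ?enum_uniq //.
  move=> w; rewrite mem_words213; apply/andP/mapP => [[aw pw]|[s]]; last first.
    by rewrite mem_enum inE -av_word => ? ->.
  have sw : size w = n by rewrite (perm_size pw) size_iota.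
  have wlt (i : 'I_n) : ((nth 0%N w i).-1 < n)%N.
    have : nth 0%N w i \in iota 1 n by rewrite -(perm_mem pw) mem_nth ?sw.
    rewrite mem_iota; lia.
  have wE (i : 'I_n) : (nth 0%N w i).-1.+1 = nth 0%N w i.
    have : nth 0%N w i \in iota 1 n by rewrite -(perm_mem pw) mem_nth ?sw.
    rewrite mem_iota; lia.
  (* The preimage of w sends i to its i-th letter minus 1; distinct letters make this a
     permutation. *)
  have f_inj : injective (fun i : 'I_n => Ordinal (wlt i)).
    move=> i j [] /(congr1 succn); rewrite !wE => /eqP.
    by rewrite nth_uniq ?sw // ?(perm_uniq pw) ?iota_uniq // => /eqP /val_inj.
  have wE' : w = word (perm f_inj).
    apply: (@eq_from_nth _ 0%N) => [|i]; rewrite ?size_word // sw => ni.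
    by rewrite (nth_word _ (Ordinal ni)) /letter permE /= (wE (Ordinal ni)).
  by exists (perm f_inj) => //; rewrite mem_enum inE -av_word -wE'.
rewrite (perm_big _ words_E) big_map big_enum.
by apply: eq_bigr => s _; rewrite H_word.
Qed.

Theorem theorem4p3 :
  (forall n : nat, (1 <= n)%N ->
     (Htotal n)%:R = n%:R / 2%:R * 'C(2 * n, n)%:R - 4%:R ^+ (n - 1) :> rat)
  /\
  Hogf =1 fps_mul fps_X (fps_binomial (- 4%:R) (- (3%:R / 2%:R)))
          \- fps_mul fps_X (fps_binomial (- 4%:R) (- 1)).
Proof.
have closed n : (1 <= n)%N ->
    (Htotal n)%:R = n%:R / 2%:R * 'C(2 * n, n)%:R - 4%:R ^+ (n - 1) :> rat.
  (* Taking m = 1 kills the Catalan term, and a positive length kills the correction. *)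
  case: n => // n _; rewrite Htotal_words213 natr_sum sum_word_H_words213.
  by rewrite exprS subn1 /=; field.
split=> // -[|n]; rewrite /Hogf /= !fps_mulX ?subrr //.
by rewrite closed // subn1 fps_binomial_central_binomial fps_binomial_pow4.
Qed.
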